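(* Let $p$ be an odd prime, $q$ a power of $p$, $\xi$ a generator of the cyclic group $\mathbb F_q^*$, $\ell$ an odd prime with $\ell\neq p$ and $\gcd(\ell,q-1)=1$, and $m,n$ positive integers. Let $\lambda\in\mathbb F_q^*$ and let $C$ be a $\lambda$-constacyclic code of length $2\ell^mp^n$ over $\mathbb F_q$. Then one of the following holds. (A) $\lambda\in\langle\xi^2\rangle$. Then there is $a\in\mathbb F_q^*$ with $a^{2\ell^mp^n}\lambda=1$, and $$C=\Big\langle \prod_{i=0}^{e}\hat M_{\rho_i}(aX)^{\varepsilon_i}\hat M_{\rho_i}(-aX)^{\epsilon_i}\Big\rangle$$ for some integers $0\le \varepsilon_i,\epsilon_i\le p^n$, $i=0,1,\dots,e$. (B) $\lambda\notin\langle\xi^2\rangle$. Then there is $b\in\mathbb F_q^*$ with $b^{2\ell^mp^n}\lambda=\xi^{p^n}$, and: (B1) if $f=\mathrm{ord}_\ell(q)$ is odd, then $$C=\Big\langle \prod_{i=0}^{e}\hat S_i(bX)^{\varepsilon_i}\Big\rangle$$ for some integers $0\le\varepsilon_i\le p^n$, $i=0,\dots,e$, where $S_i(X)=\hat M_{\rho_i}(\beta_1X)\hat M_{\rho_i}(-\beta_1X)$; (B2) if $f=\mathrm{ord}_\ell(q)$ is even, then $$C=\Big\langle \hat P(bX)^{\varepsilon}\prod_{i=1}^{e}\hat Q_i(bX)^{\varepsilon_i}\hat R_i(bX)^{\epsilon_i}\Big\rangle$$ for some integers $0\le \varepsilon,\varepsilon_i,\epsilon_i\le p^n$, $i=1,\dots,e$,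 where $P(X)=(X-\beta_1^{-1})(X+\beta_1^{-1})$, $Q_i(X)=\hat N_{\rho_i}(\beta_1X)\hat N_{\rho_iq}(-\beta_1X)$ and $R_i(X)=\hat N_{\rho_iq}(\beta_1X)\hat N_{\rho_i}(-\beta_1X)$.
   Context: For $\mu\in\mathbb F_q^*$, a $\mu$-constacyclic code of length $N$ over $\mathbb F_q$ is a linear subspace of $\mathbb F_q^N$ closed under $(c_0,\dots,c_{N-1})\mapsto(\mu c_{N-1},c_0,\dots,c_{N-2})$; such codes are identified with ideals of $\mathbb F_q[X]/\langle X^N-\mu\rangle$, and $\langle g(X)\rangle$ denotes the ideal generated by the image of $g(X)$. For a nonzero polynomial $h$ with leading coefficient $c$, $\hat h=c^{-1}h$ (the monic associate). $\langle\xi^k\rangle$ denotes the subgroup of $\mathbb F_q^*$ generated by $\xi^k$. For an integer $t$, the $q$-cyclotomic coset of $t$ modulo $\ell^m$ is $C_t=\{tq^i \bmod \ell^m: i\ge 0\}$; let $\rho_0=0,\rho_1,\dots,\rho_e$ be representatives of all the distinct $q$-cyclotomic cosets modulo $\ell^m$. Let $\eta$ be a primitive $\ell^m$-th root of unity in an extension field of $\mathbb F_q$ and $M_t(X)=\prod_{s\in C_t}(X-\eta^s)$ (the minimal polynomial of $\eta^t$ over $\mathbb F_q$). When $f=\mathrm{ord}_\ell(q)$ is even, for an integer $t$ let $D_t=\{tq^{2i}\bmod \ell^m:i\ge0\}$ be its $q^2$-cyclotomic coset; then for $1\le k\le e$, $C_{\rho_k}$ is the disjoint union of $D_{\rho_k}$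 and $D_{\rho_kq}$, and $N_t(X)=\prod_{s\in D_t}(X-\eta^s)$. Let $\alpha_1\in\mathbb F_{q^2}$ with $\alpha_1^2=\xi$, and let $\beta_1$ be the unique primitive $2(q-1)$-th root of unity in $\mathbb F_{q^2}$ with $\beta_1^{\ell^m}\alpha_1=1$. *)

(* Defs.v *)
From HB Require Import structures.
From mathcomp Require Import all_boot all_order all_algebra all_field.
Set Implicit Arguments. Unset Strict Implicit. Unset Printing Implicit Defensive.
Import GRing.Theory.
Local Open Scope ring_scope.

Section Codes.
Variables (F : fieldType) (N : nat).

Definition vnth (c : 'rV[F]_N) (k : nat) : F :=
  if (insub k : option 'I_N) is Some j then c 0 j else 0.

Definition constashift (mu : F) (c : 'rV[F]_N) : 'rV[F]_N :=
  \row_(i < N) (if (i : nat) == 0%N then mu * vnth c N.-1 else vnth c i.-1).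

Definition constacyclic (mu : F) (C : {vspace 'rV[F]_N}) : Prop :=
  forall c, c \in C -> constashift mu c \in C.

Definition poly_of_row (c : 'rV[F]_N) : {poly F} := \poly_(i < N) vnth c i.

(* c belongs to the ideal <g> of F[X]/<X^N - mu> *)
Definition in_ideal (mu : F) (g : {poly F}) (c : 'rV[F]_N) : Prop :=
  exists h : {poly F}, poly_of_row c = (h * g) %% ('X^N - mu%:P).

(* C = <g>, where g is a polynomial over an extension L of F which has all its
   coefficients in F (g = image of g0 in L[X]) *)
Definition generated_by (L : fieldExtType F) (mu : F) (C : {vspace 'rV[F]_N})
    (g : {poly L}) : Prop :=
  exists g0 : {poly F}, map_poly (in_alg L) g0 = g /\
    (forall c, c \in C <-> in_ideal mu g0 c).
End Codes.

(* the Q-cyclotomic coset {t Q^i mod M : i >= 0}, listed without repetition.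
   Since gcd(Q,M)=1 in our use, the exponents 0 <= i < M already give all elements. *)
Definition cyc_coset (Q M t : nat) : seq nat :=
  undup [seq (t * Q ^ i) %% M | i <- iota 0 M]%N.

(* multiplicative order of q modulo l (for coprime q, l > 1: it is < l) *)
Definition ord_mod (l q : nat) : nat :=
  find (fun k => (0 < k) && (q ^ k %% l == 1 %% l))%N (iota 0 l).

Section Polys.
Variable (L : fieldType).

Definition monic_assoc (h : {poly L}) : {poly L} := (lead_coef h)^-1 *: h.

Definition hatc (h : {poly L}) (c : L) : {poly L} :=
  monic_assoc (h \Po (c *: 'X)).

(* prod_{s in coset} (X - eta^s): with Q = q this is M_t, with Q = q^2 it is N_t *)
Definition cyc_poly (eta : L) (Q M t : nat) : {poly L} :=
  \prod_(s <- cyc_coset Q M t) ('X - (eta ^+ s)%:P).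
End Polys.

(* Main.v *)
Require Import Defs.
From HB Require Import structures.
From mathcomp Require Import all_boot all_order all_algebra all_field.
Set Implicit Arguments. Unset Strict Implicit. Unset Printing Implicit Defensive.
Import GRing.Theory.
Local Open Scope ring_scope.

(** A constacyclic code is an ideal of the principal ring [F[X]/(X^N - lam)],
    hence generated by a monic divisor of [X^N - lam]; so everything reduces to
    factoring [X^N - lam] into irreducibles over [F].  Put [c = a] in case (A)
    and [c = beta1 * b] in case (B): then [c^N * lam = 1], and over [L] the
    polynomial [X^N - lam] is the [p^n]-th power of
    [(X^(l^m) - c^-(l^m)) * (X^(l^m) + c^-(l^m))], whose roots are the
    [+- c^-1 * eta^s].  A product of distinct linear factors is the image of an
    irreducible polynomial over [F] exactly when its roots form one orbit of the
    [q]-Frobenius.  If [c^q = c], the orbits are the [+ c^-1 * eta^s] and the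
    [- c^-1 * eta^s] with [s] in one [q]-coset.  If [c^q = - c], Frobenius also
    switches the sign, and the orbits are [c^-1 * eta^s], [s] in [D_t], together
    with [- c^-1 * eta^s], [s] in [D_(tq)].  When [f] is odd,
    [D_t = D_(tq) = C_t]; when [f] is even and [t <> 0], [C_t] is the disjoint
    union of [D_t] and [D_(tq)]. *)

(** * Constacyclic codes as ideals of [F[X]/(X^N - mu)] *)

Section ConstacyclicIdeal.
Variables (F : fieldType) (N : nat) (mu : F).
Hypothesis N_gt0 : (0 < N)%N.
Local Notation P := ('X^N - mu%:P : {poly F}).
Implicit Types h k : {poly F}.

Lemma size_Xn_sub_const : size P = N.+1.
Proof. exact: size_XnsubC. Qed.

(** This inverts [poly_of_row] on reduced polynomials and makes sense for every polynomial, so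
    membership in [C] can be tested on any representative of a class. *)
Definition residue_row (h : {poly F}) : 'rV[F]_N := \row_(i < N) (h %% P)`_i.

Lemma size_mod_Xn_sub_const h : (size (h %% P)%R <= N)%N.
Proof. by rewrite -ltnS -size_Xn_sub_const ltn_modp -size_poly_gt0 size_Xn_sub_const. Qed.

Lemma vnthE (c : 'rV[F]_N) (i : 'I_N) : vnth c i = c 0 i.
Proof. by rewrite /vnth valK. Qed.

Lemma coef_poly_of_row (c : 'rV[F]_N) (i : 'I_N) : (poly_of_row c)`_i = c 0 i.
Proof. by rewrite coef_poly ltn_ord vnthE. Qed.

Lemma poly_of_residue_row h : poly_of_row (residue_row h) = h %% P.
Proof.
apply/polyP => i; rewrite coef_poly; case: ltnP => [lt_i|le_i].
  by rewrite (vnthE _ (Ordinal lt_i)) mxE.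
by rewrite nth_default // (leq_trans (size_mod_Xn_sub_const h)).
Qed.

Lemma poly_of_row_mod (c : 'rV[F]_N) : poly_of_row c %% P = poly_of_row c.
Proof. by rewrite modp_small // size_Xn_sub_const ltnS size_poly. Qed.

Lemma residue_poly_of_row (c : 'rV[F]_N) : residue_row (poly_of_row c) = c.
Proof. by apply/rowP => i; rewrite mxE poly_of_row_mod coef_poly_of_row. Qed.

Lemma residue_rowD h1 h2 : residue_row (h1 + h2) = residue_row h1 + residue_row h2.
Proof. by apply/rowP => i; rewrite !mxE modpD coefD. Qed.

Lemma residue_rowZ a h : residue_row (a *: h) = a *: residue_row h.
Proof. by apply/rowP => i; rewrite !mxE modpZl coefZ. Qed.

Lemma residue_row_eq0 h : P %| h -> residue_row h = 0.
Proof. by move=> /modp_eq0P h0; apply/rowP => i; rewrite !mxE h0 coef0. Qed.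

(** After multiplication by [X] the reduced residue has degree at most [N]; subtracting its top
    coefficient times the monic [P] brings the degree below [N] again. *)
Lemma mod_mulX h :
  ('X * h) %% P = 'X * (h %% P) - (h %% P)`_N.-1 *: P.
Proof.
set r := h %% P; set k := r`_N.-1.
have sr : (size r <= N)%N by apply: size_mod_Xn_sub_const.
rewrite {1}(divp_eq h P) -/r mulrDr modpD mulrA modp_mull add0r.
rewrite -[X in X %% _](subrK (k *: P)) modpD -mul_polyC modp_mull addr0 modp_small //.
rewrite size_Xn_sub_const ltnS; apply/leq_sizeP => j le_Nj.
rewrite mul_polyC coefB coefZ coefB coefXn coefC coefXM.
have -> /= : (j == 0%N) = false by case: j le_Nj => // /(leq_trans N_gt0).
rewrite subr0; case: eqP => [->|/eqP ne_jN]; first by rewrite mulr1 subrr.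
rewrite mulr0 subr0 nth_default // (leq_trans sr) //.
have : (N < j)%N by rewrite ltn_neqAle eq_sym ne_jN.
by case: (j).
Qed.

Lemma constashift_residue h : constashift mu (residue_row h) = residue_row ('X * h).
Proof.
have lt_last : (N.-1 < N)%N by rewrite prednK.
apply/rowP => i; rewrite !mxE mod_mulX coefB coefZ coefB coefXn coefC coefXM.
rewrite (ltn_eqF (ltn_ord i)); case: eqP => [i0|/eqP i0].
  by rewrite (vnthE _ (Ordinal lt_last)) mxE /= !sub0r mulrN opprK mulrC.
rewrite subr0 mulr0 subr0.
have lt_i : (i.-1 < N)%N by rewrite (leq_ltn_trans (leq_pred i)).
by rewrite (vnthE _ (Ordinal lt_i)) mxE.
Qed.

Variable C : {vspace 'rV[F]_N}.
Hypothesis C_cyc : constacyclic mu C.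

(** Horner induction on [k]: linearity absorbs the constant term, and the factor [X] acts as the
    constacyclic shift. *)
Lemma residue_row_mul h k : residue_row h \in C -> residue_row (k * h) \in C.
Proof.
move=> hC; elim/poly_ind: k => [|k a IHk].
  by rewrite mul0r residue_row_eq0 ?mem0v ?dvdp0.
rewrite mulrDl residue_rowD mul_polyC residue_rowZ memvD ?memvZ //.
by rewrite mulrAC mulrC -constashift_residue C_cyc.
Qed.

(** The divisor is an iterated gcd, kept in [C] by Bezout. The iteration starts from [P], which
    represents the zero word, so every later gcd still divides [P]. *)
Lemma common_divisor_residue (s : seq {poly F}) :
  (forall h, h \in s -> residue_row h \in C) ->
  exists g, [/\ residue_row g \in C, g %| P & forall h, h \in s -> g %| h].
Proof.
elim: s => [|h s IHs] sC.
  by exists P; split=> //; rewrite residue_row_eq0 ?mem0v.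
have [k ks|g [gC gP gs]] := IHs; first by apply: sC; rewrite inE ks orbT.
have [[u v] /= uv] := Bezoutp h g; exists (u * h + v * g); split.
- by rewrite residue_rowD memvD ?residue_row_mul // sC ?mem_head.
- by rewrite (eqp_dvdl _ uv) (dvdp_trans (dvdp_gcdr _ _)).
move=> k; rewrite inE (eqp_dvdl _ uv) => /predU1P[->|/gs gk].
  exact: dvdp_gcdl.
exact: dvdp_trans (dvdp_gcdr _ _) gk.
Qed.

Lemma poly_of_row_sum I (r : seq I) (f : I -> 'rV[F]_N) (a : I -> F) :
  poly_of_row (\sum_(i <- r) a i *: f i) = \sum_(i <- r) a i *: poly_of_row (f i).
Proof.
apply/polyP => j; rewrite coef_sum coef_poly; case: ltnP => [lt_j|le_j].
  rewrite (vnthE _ (Ordinal lt_j)) summxE; apply: eq_bigr => i _.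
  by rewrite mxE coefZ (coef_poly_of_row _ (Ordinal lt_j)).
by rewrite big1 // => i _; rewrite coefZ coef_poly ltnNge le_j mulr0.
Qed.

(** The gcd of [P] with the polynomials of a basis of [C] divides every combination of that basis;
    dividing by its leading coefficient makes it monic. *)
Lemma constacyclic_generator :
  exists g : {poly F}, [/\ g \is monic, g %| P & forall c, c \in C <-> in_ideal mu g c].
Proof.
have [h /mapP[c cC ->]|g [gC gP gs]] := @common_divisor_residue [seq poly_of_row c | c <- vbasis C].
  by rewrite residue_poly_of_row vbasis_mem.
have P0 : P != 0 by rewrite -size_poly_gt0 size_Xn_sub_const.
have g0 : g != 0 by apply: contraTneq gP => ->; rewrite dvd0p.
have lg0 : lead_coef g != 0 by rewrite lead_coef_eq0.
exists ((lead_coef g)^-1 *: g); split.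
- by rewrite monicE lead_coefZ mulVf.
- by rewrite dvdpZl ?invr_eq0.
move=> c; split=> [cC|[h def_c]].
  have /dvdpP[h def_c] : (lead_coef g)^-1 *: g %| poly_of_row c.
    rewrite dvdpZl ?invr_eq0 // (coord_vbasis cC) poly_of_row_sum.
    apply: (big_ind (fun h => g %| h)); [exact: dvdp0 | exact: dvdp_add |] => i _.
    by rewrite -mul_polyC dvdp_mull // gs // map_f // mem_nth // size_tuple.
  by exists h; rewrite -def_c poly_of_row_mod.
rewrite -[c]residue_poly_of_row def_c -poly_of_residue_row residue_poly_of_row.
by rewrite -mul_polyC mulrA residue_row_mul.
Qed.
End ConstacyclicIdeal.

(** * Monic divisors of products of powers of irreducible polynomials *)

Section Divisors.
Variable F : fieldType.
Implicit Types g u v U V : {poly F}.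

(** Take for [u] the monic gcd of [g] and [U]: the cofactors [g / u] and [U / u] are coprime, so
    Gauss's lemma forces [g / u] to divide [V]. *)
Lemma monic_dvdp_mul_split g U V :
  g \is monic -> g %| U * V ->
  exists u v, [/\ u \is monic, v \is monic, u %| U, v %| V & g = u * v].
Proof.
move=> g_mon gUV.
have g0 := monic_neq0 g_mon.
pose d := gcdp g U.
have d0 : d != 0 by rewrite gcdp_eq0 negb_and g0.
have ld0 : (lead_coef d)^-1 != 0 by rewrite invr_eq0 lead_coef_eq0.
pose u := (lead_coef d)^-1 *: d.
have u_mon : u \is monic by rewrite monicE lead_coefZ mulVf // -invr_eq0.
have ud : u %= d by rewrite eqp_scale.
have /dvdpP[v def_g] : u %| g by rewrite (eqp_dvdl _ ud) dvdp_gcdl.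
have /dvdpP[w def_U] : u %| U by rewrite (eqp_dvdl _ ud) dvdp_gcdr.
have u0 := monic_neq0 u_mon.
have v_mon : v \is monic by rewrite -(monicMl _ u_mon) mulrC -def_g.
exists u, v; split=> //; last by rewrite mulrC.
  by rewrite (eqp_dvdl _ ud) dvdp_gcdr.
have : v * u %| (w * V) * u by rewrite -def_g mulrAC -def_U.
rewrite dvdp_mul2r // Gauss_dvdpr //.
rewrite -gcdp_eqp1 -(eqp_mul2r _ _ u0) mul1r -(eqp_ltrans (gcdp_mul2r _ _ _)).
by rewrite -def_g -def_U eqp_sym.
Qed.

Lemma monic_eqp u v : u \is monic -> v \is monic -> u %= v -> u = v.
Proof.
move=> u_mon v_mon /eqpP[[a b] /= /andP[a0 b0] e].
have /(congr1 lead_coef) := e; rewrite !lead_coefZ (monicP u_mon) (monicP v_mon) !mulr1.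
by move=> ab; move: e; rewrite ab => /(scalerI b0).
Qed.

(** One copy of [U] is split off at a time, and a monic divisor of [U] is [1] or [U]. *)
Lemma monic_dvdp_irreducible_exp U g k :
  irreducible_poly U -> U \is monic -> g \is monic -> g %| U ^+ k ->
  exists2 j, (j <= k)%N & g = U ^+ j.
Proof.
move=> U_irr U_mon; elim: k g => [|k IHk] g g_mon.
  rewrite expr0 dvdp1 => /eqP g1; exists 0%N => //; rewrite expr0.
  by apply: monic_eqp; rewrite ?monic1 // -size_poly_eq1 g1.
rewrite exprS => /(monic_dvdp_mul_split g_mon)[u [v [u_mon v_mon uU vU ->]]].
have [j le_jk ->] := IHk v v_mon vU.
have [u1|u1] := boolP (size u == 1%N).
  exists j; first exact: leqW.
  by rewrite (@monic_eqp u 1) ?mul1r ?monic1 // -size_poly_eq1.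
exists j.+1 => //; rewrite exprS; congr (_ * _).
by apply: monic_eqp => //; apply: U_irr.
Qed.

Lemma monic_dvdp_prod_irreducible_exp (I : eqType) (r : seq I) (G : I -> {poly F}) k g :
  uniq r -> (forall i, i \in r -> irreducible_poly (G i) /\ G i \is monic) ->
  g \is monic -> g %| \prod_(i <- r) G i ^+ k ->
  exists2 eps : I -> nat, forall i, (eps i <= k)%N
    & g = \prod_(i <- r) G i ^+ eps i.
Proof.
elim: r g => [|i0 r IHr] g /= r_uniq G_irr g_mon.
  rewrite big_nil dvdp1 => /eqP g1; exists (fun=> 0%N) => //.
  by rewrite big_nil; apply: monic_eqp; rewrite ?monic1 // -size_poly_eq1 g1.
case/andP: r_uniq => i0r r_uniq.
rewrite big_cons => /(monic_dvdp_mul_split g_mon)[u [v [u_mon v_mon uU vV ->]]].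
have [|eps le_eps ->] := IHr v r_uniq _ v_mon vV.
  by move=> i ir; apply: G_irr; rewrite inE ir orbT.
have [Gi_irr Gi_mon] := G_irr i0 (mem_head _ _).
have [j le_jk ->] := monic_dvdp_irreducible_exp Gi_irr Gi_mon u_mon uU.
(* Setting the exponent at [i0] disturbs no other one, since [i0] does not occur in [r]. *)
exists (fun i => if i == i0 then j else eps i) => [i|]; first by case: eqP.
rewrite big_cons eqxx; congr (_ * _); apply: eq_big_seq => i ir.
by case: eqP i0r => // <-; rewrite ir.
Qed.
End Divisors.

(** * The [q]-Frobenius of an extension, and irreducibility from its orbits *)

Section FrobeniusOrbits.
Variables (F : finFieldType) (L : fieldExtType F).
Local Notation q := #|F|.

Lemma finField_card_gt0 : (0 < q)%N.
Proof. exact: ltn_trans (finNzRing_gt1 F). Qed.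

Lemma fixed_expf_card (y : L) : y ^+ q = y -> exists x : F, y = x%:A.
Proof.
move=> yq; have : y \in 1%AS by rewrite Fermat's_little_theorem /= dimv1 expn1 yq.
by case/vlineP=> x ->; exists x.
Qed.

Lemma expf_card_in_alg (x : F) : (x%:A : L) ^+ q = x%:A.
Proof. by rewrite -[x%:A]/(in_alg L x) -rmorphXn /= expf_card. Qed.

Lemma pchar_nat_card : [pchar L].-nat q.
Proof.
have [p p_pr pF] := finPcharP F.
have pL : p \in [pchar L] by rewrite pchar_lalg.
rewrite (card_pprimeChar pF) pnatX; apply/orP; left.
by rewrite pnatE.
Qed.

Definition frob_card (y : L) : L := y ^+ q.

Lemma frob_card_is_nmod_morphism : nmod_morphism frob_card.
Proof.
split=> [|x y]; last by rewrite /frob_card exprDn_pchar ?pchar_nat_card.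
by rewrite /frob_card expr0n (gtn_eqF finField_card_gt0).
Qed.
HB.instance Definition _ :=
  GRing.isNmodMorphism.Build L L frob_card frob_card_is_nmod_morphism.

Lemma frob_card_is_monoid_morphism : monoid_morphism frob_card.
Proof. by split=> [|x y]; rewrite /frob_card ?expr1n ?exprMn. Qed.
HB.instance Definition _ :=
  GRing.isMonoidMorphism.Build L L frob_card frob_card_is_monoid_morphism.

(** [L] has finite degree over the finite field [F]. The period lets a Frobenius orbit be run
    backwards. *)
Lemma expf_card_period : exists2 d, (0 < d)%N & forall y : L, y ^+ (q ^ d) = y.
Proof.
exists (\dim {:L}); first exact: adim_gt0.
by move=> y; apply/eqP; rewrite -Fermat's_little_theorem memvf.
Qed.

Lemma map_in_alg_frob (g : {poly F}) :
  map_poly frob_card (map_poly (in_alg L) g) = map_poly (in_alg L) g.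
Proof. by apply/polyP => i; rewrite !coef_map /= /frob_card expf_card_in_alg. Qed.

Lemma root_map_frob (g : {poly F}) (y : L) k :
  root (map_poly (in_alg L) g) y -> root (map_poly (in_alg L) g) (y ^+ (q ^ k)).
Proof.
elim: k => [|k IHk] in y *; first by rewrite expn0 expr1.
move=> gy; rewrite expnS exprM; apply: IHk.
by rewrite -[y ^+ q]/(frob_card y) -map_in_alg_frob rootE horner_map (eqP gy) rmorph0.
Qed.

(** Irreducibility over [F] of a polynomial written over [L]; the preimage is existential, as in
    [generated_by]. *)
Definition irreducible_image (g : {poly L}) : Prop :=
  exists g0 : {poly F},
    [/\ irreducible_poly g0, g0 \is monic & map_poly (in_alg L) g0 = g].

Lemma frob_fixed_polyP (g : {poly L}) :
  map_poly frob_card g = g -> exists g0 : {poly F}, map_poly (in_alg L) g0 = g.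
Proof.
(* [inv] picks a preimage in [F], with default [0] off the image; only Frobenius-fixed arguments
   matter below. *)
move=> g_fix; pose inv (y : L) : F := odflt 0 [pick x | x%:A == y].
have invK (x : L) : x ^+ q = x -> (inv x)%:A = x.
  move=> /fixed_expf_card[x0 ->]; rewrite /inv; case: pickP => [x1 /eqP //|/(_ x0)].
  by rewrite eqxx.
exists (map_poly inv g); apply/polyP => i; rewrite coef_map /= coef_map_id0 ?invK //.
  by rewrite -{2}g_fix coef_map.
by apply: (fmorph_inj (in_alg L)); rewrite /= invK ?scale0r //
  expr0n (gtn_eqF finField_card_gt0).
Qed.

(** Frobenius permutes [r], so the product has its coefficients in [F]. A nonconstant divisor over
    [F] has a root in [r], hence has the whole orbit as roots. *)
Lemma frob_orbit_irreducible (x : L) (r : seq L) :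
  uniq r -> x \in r -> {in r, forall y, y ^+ q \in r} ->
  {in r, forall y, exists k, y = x ^+ (q ^ k)} ->
  irreducible_image (\prod_(y <- r) ('X - y%:P)).
Proof.
move=> r_uniq xr r_frob r_orb; set g := \prod_(y <- r) _.
have g_fix : map_poly frob_card g = g.
  rewrite rmorph_prod /= (eq_bigr (fun y => 'X - (frob_card y)%:P)); last first.
    by move=> y _; rewrite map_polyXsubC.
  rewrite -(big_map frob_card predT (fun y => 'X - y%:P)); apply: perm_big.
  have fr_uniq : uniq (map frob_card r) by rewrite map_inj_uniq //; apply: fmorph_inj.
  apply: uniq_perm => //.
  (* An injective map of the finite list [r] into itself is onto. *)
  apply: (uniq_min_size _ _ _).2 => //; last by rewrite size_map.
  by move=> _ /mapP[y yr ->]; apply: r_frob.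
have [g0 def_g0] := frob_fixed_polyP g_fix; exists g0; split=> //; last first.
  by rewrite -(map_monic (in_alg L)) def_g0 monic_prod_XsubC.
split=> [|h h_size h_dvd].
  rewrite -(size_map_poly (in_alg L)) def_g0 size_prod_XsubC ltnS.
  by case: (r) xr.
rewrite /eqp h_dvd -(dvdp_map (in_alg L)) def_g0.
have : map_poly (in_alg L) h %| g by rewrite -def_g0 dvdp_map.
case/dvdp_prod_XsubC => msk h_eq.
have [y0 y0r] : exists y, y \in mask msk r.
  case def_s: (mask msk r) => [|y s]; last by exists y; rewrite mem_head.
  case/negP: h_size; rewrite -(size_map_poly (in_alg L)) (eqp_size h_eq).
  by rewrite def_s big_nil size_poly1.
have hy0 : root (map_poly (in_alg L) h) y0.
  by rewrite (eqp_root h_eq) root_prod_XsubC.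
have [d d_gt0 y_per] := expf_card_period.
have y_per_mul (y : L) j : y ^+ (q ^ (d * j)) = y.
  elim: j => [|j IHj]; first by rewrite muln0 expr1.
  by rewrite mulnS expnD exprM y_per.
have [i def_y0] := r_orb _ (mem_mask y0r).
(* From [y0 = x^(q^i)], another [d * i - i] Frobenius steps complete whole periods and return to
   [x]. *)
have hx : root (map_poly (in_alg L) h) x.
  have := root_map_frob (d * i - i) hy0; rewrite def_y0 -exprM -expnD subnKC ?y_per_mul //.
  by rewrite leq_pmull.
apply: uniq_roots_dvdp; last by rewrite uniq_rootsE.
apply/allP => y /r_orb[k ->]; exact: root_map_frob.
Qed.
End FrobeniusOrbits.

(** * Cyclotomic cosets as classes of a partition of the residues *)

Section CyclotomicCosets.
Local Open Scope nat_scope.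
Variables Q M : nat.
Hypotheses (M_gt0 : 0 < M) (QM : coprime Q M).

Lemma expn_mod_period : exists2 d, 0 < d <= M & Q ^ d = 1 %[mod M].
Proof.
exists (totient M); last exact: cyclic.Euler_exp_totient.
rewrite totient_gt0 M_gt0 totient_count_coprime.
rewrite -[leqRHS]muln1 -[M in leqRHS]subn0 -sum_nat_const_nat.
by apply: leq_sum => i _; case: coprime.
Qed.

Lemma expn_mod_period_mul d j : Q ^ d = 1 %[mod M] -> Q ^ (d * j) = 1 %[mod M].
Proof. by move=> Qd; rewrite expnM -modnXm Qd modnXm exp1n. Qed.

(** The powers of [Q] have a period [d <= M], so reducing an arbitrary exponent modulo [d] lands
    among the exponents listed by [cyc_coset]. *)
Lemma mem_cyc_coset t s :
  reflect (exists k, s = (t * Q ^ k) %% M) (s \in cyc_coset Q M t).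
Proof.
rewrite mem_undup; apply: (iffP mapP) => [[k _ ->]|[k ->]]; first by exists k.
have [d /andP[d_gt0 le_dM] Qd] := expn_mod_period.
exists (k %% d); first by rewrite mem_iota add0n (leq_trans _ le_dM) ?ltn_pmod.
have Qk : Q ^ k = Q ^ (k %% d) %[mod M].
  rewrite {1}(divn_eq k d) [_ %/ d * d]mulnC expnD -modnMml expn_mod_period_mul //.
  by rewrite modnMml mul1n.
by rewrite -modnMmr Qk modnMmr.
Qed.

Lemma cyc_coset_lt t s : s \in cyc_coset Q M t -> s < M.
Proof. by case/mem_cyc_coset=> k ->; rewrite ltn_pmod. Qed.

Lemma cyc_coset_uniq t : uniq (cyc_coset Q M t).
Proof. exact: undup_uniq. Qed.

Lemma mem_cyc_coset_id t : t %% M \in cyc_coset Q M t.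
Proof. by apply/mem_cyc_coset; exists 0; rewrite muln1. Qed.

Lemma cyc_coset_mulr t s : s \in cyc_coset Q M t -> (s * Q) %% M \in cyc_coset Q M t.
Proof.
case/mem_cyc_coset=> k ->; apply/mem_cyc_coset; exists k.+1.
by rewrite modnMml expnSr mulnA.
Qed.

Lemma cyc_coset_sub t u s :
  s \in cyc_coset Q M t -> s \in cyc_coset Q M u ->
  {subset cyc_coset Q M t <= cyc_coset Q M u}.
Proof.
case/mem_cyc_coset=> i s_t /mem_cyc_coset[j s_u] y /mem_cyc_coset[k ->].
have [d /andP[d_gt0 _] Qd] := expn_mod_period.
(* The exponent goes from [u] to [s], then back to [t] by completing periods, then on to [y]. *)
apply/mem_cyc_coset; exists (j + (d * i - i) + k).
rewrite !expnD !mulnA -modnMml -[in RHS]modnMml; congr ((_ * _) %% _).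
rewrite -[RHS]modnMml -s_u s_t modnMml -mulnA -expnD subnKC ?leq_pmull //.
by rewrite -modnMmr expn_mod_period_mul // modnMmr muln1.
Qed.

Lemma cyc_coset_eq t u s :
  s \in cyc_coset Q M t -> s \in cyc_coset Q M u ->
  cyc_coset Q M t =i cyc_coset Q M u.
Proof. by move=> st su y; apply/idP/idP; apply: cyc_coset_sub; eassumption. Qed.

Lemma perm_flatten_cyc_cosets e (rho : nat -> nat) :
  (forall i j, i <= e -> j <= e -> i != j ->
     ~ (cyc_coset Q M (rho i) =i cyc_coset Q M (rho j))) ->
  (forall s, s < M -> exists2 i, i <= e & s \in cyc_coset Q M (rho i)) ->
  perm_eq [seq s | i <- iota 0 e.+1, s <- cyc_coset Q M (rho i)] (iota 0 M).
Proof.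
move=> rho_inj rho_cover; apply: uniq_perm; rewrite ?iota_uniq //.
  apply: allpairs_uniq_dep; rewrite ?iota_uniq //; first by move=> i _; apply: cyc_coset_uniq.
  move=> _ _ /allpairsPdep[i [s [ie si ->]]] /allpairsPdep[j [u [je uj ->]]] /= su.
  rewrite -{}su in uj *; have [->//|ne_ij] := eqVneq i j.
  rewrite !mem_iota !add0n !ltnS /= in ie je.
  by case: (rho_inj i j ie je ne_ij); apply: cyc_coset_eq si uj.
move=> s; rewrite mem_iota add0n leq0n andTb; apply/allpairsPdep/idP => [[i [u [_ ui ->]]]|sM].
  exact: cyc_coset_lt ui.
by have [i ie si] := rho_cover s sM; exists i, s; rewrite mem_iota add0n ltnS.
Qed.
End CyclotomicCosets.

(** * Comparison of [q]-cosets with [q^2]-cosets *)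

Section OddEvenOrder.
Local Open Scope nat_scope.
Variables q M : nat.
Hypotheses (M_gt0 : 0 < M) (qM : coprime q M).

Lemma coprime_sqr : coprime (q ^ 2) M.
Proof. by rewrite coprimeXl. Qed.

(** Adding the odd period [d] to an odd exponent makes it even without changing the residue. *)
Lemma cyc_coset_odd_period d t : odd d -> q ^ d = 1 %[mod M] ->
  perm_eq (cyc_coset (q ^ 2) M t) (cyc_coset q M t).
Proof.
move=> d_odd qd; apply: uniq_perm; rewrite ?cyc_coset_uniq // => s.
apply/(mem_cyc_coset M_gt0 coprime_sqr)/(mem_cyc_coset M_gt0 qM) => -[k ->].
  by exists (2 * k); rewrite -expnM.
have [k_odd|k_even] := boolP (odd k); last first.
  by exists k./2; rewrite -expnM mul2n even_halfK.
exists (k + d)./2; rewrite -expnM mul2n even_halfK ?oddD ?k_odd ?d_odd //.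
by rewrite expnD mulnA -[RHS]modnMmr qd modnMmr muln1.
Qed.

Lemma cyc_coset_odd_period_mul d t : odd d -> q ^ d = 1 %[mod M] ->
  perm_eq (cyc_coset (q ^ 2) M (t * q)) (cyc_coset q M t).
Proof.
move=> d_odd qd; apply: (perm_trans (cyc_coset_odd_period (t * q) d_odd qd)).
apply: uniq_perm; rewrite ?cyc_coset_uniq //.
apply: (cyc_coset_eq M_gt0 qM (mem_cyc_coset_id M_gt0 qM _)).
by apply/(mem_cyc_coset M_gt0 qM); exists 1; rewrite expn1.
Qed.

(** Even exponents give the coset of [t] and odd ones that of [t * q]; the hypothesis keeps the two
    parities apart. *)
Lemma cyc_coset_split t :
  (forall i j, ~~ odd i -> odd j -> t * q ^ i <> t * q ^ j %[mod M]) ->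
  perm_eq (cyc_coset (q ^ 2) M t ++ cyc_coset (q ^ 2) M (t * q)) (cyc_coset q M t).
Proof.
move=> t_sep; apply: uniq_perm; rewrite ?cyc_coset_uniq //.
  rewrite cat_uniq !cyc_coset_uniq andbT /=; apply/hasPn => s.
  case/(mem_cyc_coset M_gt0 coprime_sqr)=> j s_j.
  apply/(mem_cyc_coset M_gt0 coprime_sqr) => -[i s_i].
  apply: (t_sep (2 * i) (2 * j).+1); rewrite /= ?oddM //.
  by rewrite expnS mulnA !expnM -s_i s_j.
move=> s; rewrite mem_cat; apply/orP/(mem_cyc_coset M_gt0 qM) => [[]|[k ->]].
- by case/(mem_cyc_coset M_gt0 coprime_sqr)=> k ->; exists (2 * k); rewrite -expnM.
- case/(mem_cyc_coset M_gt0 coprime_sqr)=> k ->; exists (2 * k).+1.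
  by rewrite [in RHS]expnS mulnA -expnM.
have [k_odd|k_even] := boolP (odd k); [right|left];
  apply/(mem_cyc_coset M_gt0 coprime_sqr); exists k./2; rewrite -expnM mul2n.
  by rewrite -mulnA -expnS -[in LHS](odd_double_half k) k_odd.
by rewrite even_halfK.
Qed.
End OddEvenOrder.

(** * The order of [q] modulo [l] and its lift to [l^m] *)

Section MultiplicativeOrder.
Local Open Scope nat_scope.
Variables l q : nat.
Hypotheses (l_pr : prime l) (ql : coprime q l).

Lemma coprime_prime_gt0 : 0 < q.
Proof. by case: q ql => //; rewrite /coprime gcd0n => /eqP l1; move: l_pr; rewrite l1. Qed.

(** By Euler the exponent [l - 1] lies in the searched range, so [find] stops at the least positive
    solution; a nonzero remainder of [k] would be a smaller one. *)
Lemma ord_modP : [/\ 0 < ord_mod l q, q ^ ord_mod l q = 1 %[mod l]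
  & forall k, q ^ k = 1 %[mod l] -> ord_mod l q %| k].
Proof.
set P := fun k => (0 < k) && (q ^ k %% l == 1 %% l).
have hasP : has P (iota 0 l).
  apply/hasP; exists (totient l); last first.
    by rewrite /P totient_gt0 prime_gt0 //= cyclic.Euler_exp_totient.
  by rewrite mem_iota /= add0n totient_prime // ltn_predL prime_gt0.
have lt_f : ord_mod l q < l by rewrite -[ltnRHS](size_iota 0) -has_find.
have := nth_find 0 hasP; rewrite -/(ord_mod l q) nth_iota // add0n.
case/andP=> f_gt0 /eqP qf; split=> // k qk.
rewrite /dvdn -leqn0 leqNgt; apply/negP => r_gt0.
have lt_rf : k %% ord_mod l q < ord_mod l q by rewrite ltn_pmod.
have := before_find 0 lt_rf; rewrite nth_iota ?(ltn_trans lt_rf) // add0n r_gt0 /=.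
move/eqP; apply; rewrite -qk {2}(divn_eq k (ord_mod l q)) expnD [_ %/ _ * _]mulnC expnM.
by rewrite -[RHS]modnMml -[in RHS]modnXm qf modnXm exp1n modnMml mul1n.
Qed.

(** If [y = 1] modulo a positive power of [l], then [y^l - 1] is [y - 1] times a sum of [l] terms
    congruent to [1] modulo [l], which gains one factor [l]. *)
Lemma expn_prime_power_mod d m : 0 < m ->
  q ^ d = 1 %[mod l] -> q ^ (d * l ^ m.-1) = 1 %[mod l ^ m].
Proof.
case: m => // m _ qd /=; elim: m => [|m IHm]; first by rewrite muln1 expn1.
set y := q ^ (d * l ^ m) in IHm.
have y_gt0 : 0 < y by rewrite expn_gt0 coprime_prime_gt0.
rewrite [l ^ m.+1]expnSr mulnA expnM -/y; apply/eqP; move: y y_gt0 IHm => y y_gt0 IHm.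
rewrite eqn_mod_dvd ?expn_gt0 ?y_gt0 // subn1 predn_exp expnSr; apply: dvdn_mul.
  by rewrite -subn1 -eqn_mod_dvd // IHm.
have y1 : y = 1 %[mod l].
  apply/eqP; rewrite eqn_mod_dvd //; apply: (@dvdn_trans (l ^ m.+1)).
    by rewrite dvdn_exp.
  by rewrite -eqn_mod_dvd // IHm.
rewrite /dvdn -modn_summ (eq_bigr (fun=> 1 %% l)); last first.
  by move=> i _; rewrite -modnXm y1 modnXm exp1n.
by rewrite modn_summ sum_nat_const card_ord muln1 modnn.
Qed.

(** A coincidence at exponents [a <= b] of opposite parity gives [l^m %| t * (q^(b-a) - 1)]. Either
    [l] divides the second factor and the even order divides the odd [b - a], or [l^m] divides
    [t]. *)
Lemma even_ord_mod_sep m t i j : 0 < m -> ~~ odd (ord_mod l q) ->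
  ~~ (l ^ m %| t) -> ~~ odd i -> odd j -> t * q ^ i <> t * q ^ j %[mod l ^ m].
Proof.
move=> m_gt0 f_even t_ndvd i_even j_odd.
have [_ _ f_dvd] := ord_modP.
have key a b : odd a != odd b -> a <= b -> t * q ^ a <> t * q ^ b %[mod l ^ m].
  move=> ab le_ab /esym/eqP; rewrite eqn_mod_dvd ?leq_mul // ?leq_pexp2l ?coprime_prime_gt0 //.
  rewrite -{1}(subnKC le_ab) expnD -[X in _ - X]muln1 mulnA -mulnBr.
  rewrite -mulnA mulnCA Gauss_dvdr ?coprimeXl ?coprimeXr 1?coprime_sym //.
  have [l_dvd _|l_ndvd] := boolP (l %| q ^ (b - a) - 1).
    have /dvdn_odd : ord_mod l q %| b - a.
      by apply: f_dvd; apply/eqP; rewrite eqn_mod_dvd // expn_gt0 coprime_prime_gt0.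
    rewrite oddB // (negbTE f_even) => ab_even.
    by case: (odd a) (odd b) ab ab_even => [] [] //= _ /(_ isT).
  rewrite Gauss_dvdl ?(negP t_ndvd) //; first exact/negP.
  by rewrite coprimeXl // prime_coprime.
have [le_ij|/ltnW le_ji] := leqP i j; first by apply: key => //; rewrite (negbTE i_even) j_odd.
by apply/nesym; apply: key => //; rewrite (negbTE i_even) j_odd.
Qed.
End MultiplicativeOrder.

(** * The substitution [X -> c X] made monic, which scales roots by [c^-1] *)

Section MonicSubstitution.
Variable L : fieldType.
Implicit Types (f g : {poly L}) (c d : L).

Lemma hatcM f g c : hatc (f * g) c = hatc f c * hatc g c.
Proof.
by rewrite /hatc /monic_assoc comp_polyM lead_coefM invfM -scalerAl -scalerAr scalerA.
Qed.

Lemma hatc1 c : hatc 1 c = 1.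
Proof. by rewrite /hatc /monic_assoc comp_polyC lead_coefC invr1 scale1r. Qed.

Lemma hatc_prod I (r : seq I) (f : I -> {poly L}) c :
  hatc (\prod_(i <- r) f i) c = \prod_(i <- r) hatc (f i) c.
Proof. exact: (big_morph (fun f => hatc f c) (fun f g => hatcM f g c) (hatc1 c)). Qed.

Lemma hatc_monic_eq f g c d : g \is monic -> d != 0 ->
  f \Po (c *: 'X) = d *: g -> hatc f c = g.
Proof.
move=> g_mon d0 fg; rewrite /hatc /monic_assoc fg lead_coefZ (monicP g_mon) mulr1.
by rewrite scalerA mulVf ?scale1r.
Qed.

Lemma hatc_XsubC x c : c != 0 -> hatc ('X - x%:P) c = 'X - (c^-1 * x)%:P.
Proof.
move=> c0; apply: (@hatc_monic_eq _ _ _ c); rewrite ?monicXsubC //.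
by rewrite comp_polyB comp_polyX comp_polyC scalerBr -[c *: _%:P]mul_polyC -polyCM mulVKf.
Qed.

Lemma hatc_Xn_sub1 k c : (0 < k)%N -> c != 0 ->
  hatc ('X^k - 1) c = 'X^k - (c ^- k)%:P.
Proof.
move=> k_gt0 c0; apply: (@hatc_monic_eq _ _ _ (c ^+ k)); rewrite ?monicXnsubC ?expf_neq0 //.
rewrite comp_polyB comp_Xn_poly comp_polyC exprZn scalerBr.
by rewrite -[c ^+ k *: _%:P]mul_polyC -polyCM mulfV ?expf_neq0.
Qed.

Lemma hatc_prod_XsubC (r : seq L) c : c != 0 ->
  hatc (\prod_(x <- r) ('X - x%:P)) c = \prod_(x <- [seq c^-1 * x | x <- r]) ('X - x%:P).
Proof.
by move=> c0; rewrite hatc_prod big_map; apply: eq_bigr => x _; rewrite hatc_XsubC.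
Qed.

Lemma cyc_polyE (eta : L) Q M t :
  cyc_poly eta Q M t = \prod_(x <- [seq eta ^+ s | s <- cyc_coset Q M t]) ('X - x%:P).
Proof. by rewrite big_map. Qed.

Lemma hatc_cyc_poly (eta : L) Q M t c : c != 0 ->
  hatc (cyc_poly eta Q M t) c =
  \prod_(x <- [seq c^-1 * eta ^+ s | s <- cyc_coset Q M t]) ('X - x%:P).
Proof. by move=> c0; rewrite cyc_polyE hatc_prod_XsubC // -map_comp. Qed.

Lemma hatc_hatc_cyc_poly (eta : L) Q M t c d : c != 0 -> d != 0 ->
  hatc (hatc (cyc_poly eta Q M t) c) d = hatc (cyc_poly eta Q M t) (c * d).
Proof.
move=> c0 d0; rewrite !hatc_cyc_poly ?mulf_neq0 // hatc_prod_XsubC // -map_comp.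
by congr bigop; apply: eq_map => s /=; rewrite invfM mulrA [c^-1 * _]mulrC.
Qed.

Lemma perm_cyc_poly (eta : L) Q Q' M t t' :
  perm_eq (cyc_coset Q M t) (cyc_coset Q' M t') ->
  cyc_poly eta Q M t = cyc_poly eta Q' M t'.
Proof. exact: perm_big. Qed.

(** The cosets partition the exponents below [M], so before substitution the product is
    [X^M - 1]. *)
Lemma prod_hatc_cyc_poly (eta : L) Q M e (rho : nat -> nat) c :
  coprime Q M -> M.-primitive_root eta -> c != 0 ->
  (forall i j, (i <= e)%N -> (j <= e)%N -> i != j ->
     ~ (cyc_coset Q M (rho i) =i cyc_coset Q M (rho j))) ->
  (forall s, (s < M)%N -> exists2 i, (i <= e)%N & s \in cyc_coset Q M (rho i)) ->
  \prod_(0 <= i < e.+1) hatc (cyc_poly eta Q M (rho i)) c = 'X^M - (c ^- M)%:P.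
Proof.
move=> QM eta_prim c0 rho_inj rho_cover.
have M_gt0 := prim_order_gt0 eta_prim.
rewrite -hatc_prod -hatc_Xn_sub1 // -(factor_Xn_sub_1 eta_prim); congr hatc.
rewrite /index_iota !subn0 -(perm_big _ (perm_flatten_cyc_cosets M_gt0 QM rho_inj rho_cover)).
by rewrite big_allpairs_dep.
Qed.
End MonicSubstitution.

(** * The irreducible factors over [F] *)

Section IrreducibleFactors.
Variables (F : finFieldType) (L : fieldExtType F) (eta : L) (M : nat).
Local Notation q := #|F|.
Hypotheses (eta_prim : M.-primitive_root eta) (qM : coprime q M).

Let M_gt0 : (0 < M)%N := prim_order_gt0 eta_prim.

Lemma cyc_roots_uniq Q t (c : L) : c != 0 ->
  uniq [seq c^-1 * eta ^+ s | s <- cyc_coset Q M t].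
Proof.
move=> c0; rewrite map_inj_in_uniq ?cyc_coset_uniq // => s u.
rewrite !mem_undup => /mapP[i _ ->] /mapP[j _ ->] /(mulfI (invr_neq0 c0))/eqP.
by rewrite (eq_prim_root_expr eta_prim) !modn_mod => /eqP.
Qed.

Lemma root_frob (c : L) s k :
  (c^-1 * eta ^+ s) ^+ k = (c ^+ k)^-1 * eta ^+ ((s * k) %% M).
Proof. by rewrite exprMn exprVn (prim_expr_mod eta_prim) exprM. Qed.

Lemma irreducible_cyc_poly t (c : L) : c != 0 -> c ^+ q = c ->
  irreducible_image (hatc (cyc_poly eta q M t) c).
Proof.
move=> c0 cq; rewrite hatc_cyc_poly //.
have cqk k : c ^+ (q ^ k) = c by elim: k => // k IHk; rewrite expnS exprM cq.
apply: (@frob_orbit_irreducible _ _ (c^-1 * eta ^+ (t %% M))).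
- exact: cyc_roots_uniq.
- by apply/mapP; exists (t %% M)%N => //; apply: mem_cyc_coset_id.
- move=> _ /mapP[s s_t ->]; rewrite root_frob cq; apply/mapP.
  by exists ((s * q) %% M)%N => //; apply: cyc_coset_mulr.
move=> _ /mapP[s /(mem_cyc_coset M_gt0 qM)[k ->] ->]; exists k.
by rewrite root_frob cqk modnMml.
Qed.

(** Even Frobenius powers of [c^-1 * eta^t] fill the first factor's roots; odd powers also flip the
    sign and fill the second's. *)
Lemma irreducible_twisted_cyc_poly t (c : L) :
  odd M -> -1 != 1 :> L -> c != 0 -> c ^+ q = - c ->
  irreducible_image (hatc (cyc_poly eta (q ^ 2) M t) c *
                     hatc (cyc_poly eta (q ^ 2) M (t * q)) (- c)).
Proof.
move=> M_odd N1 c0 cq.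
have q2M := coprime_sqr qM.
have Ncq : (- c) ^+ q = c by rewrite -[LHS]/(frob_card (- c)) rmorphN /= /frob_card cq opprK.
have cq2 : c ^+ (q ^ 2) = c by rewrite expnS expn1 exprM cq Ncq.
have cq2k k : c ^+ ((q ^ 2) ^ k) = c by elim: k => // k IHk; rewrite expnS exprM cq2.
have Nc0 : - c != 0 by rewrite oppr_eq0.
rewrite !hatc_cyc_poly // -big_cat.
apply: (@frob_orbit_irreducible _ _ (c^-1 * eta ^+ (t %% M))).
- rewrite cat_uniq !cyc_roots_uniq // andbT; apply/hasPn => _ /mapP[s _ ->].
  (* A common root would give [- eta^s = eta^u]; raising to the odd power [M] yields [-1 = 1]. *)
  apply/mapP => -[u _] /(congr1 ( *%R c)); rewrite invrN mulNr mulrN !mulVKf //.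
  move/(congr1 (fun z => z ^+ M)); rewrite exprNn -!exprM !(mulnC _ M) !exprM.
  rewrite (prim_expr_order eta_prim) !expr1n mulr1 -signr_odd M_odd => /eqP.
  by rewrite (negbTE N1).
- rewrite mem_cat; apply/orP; left; apply/mapP; exists (t %% M)%N => //.
  exact: mem_cyc_coset_id.
- move=> y; rewrite !mem_cat => /orP[] /mapP[s /(mem_cyc_coset M_gt0 q2M)[k ->] ->];
    apply/orP; [right|left]; apply/mapP.
    exists ((t * q * (q ^ 2) ^ k) %% M)%N; first by apply/mem_cyc_coset => //; exists k.
    by rewrite root_frob cq modnMml mulnAC.
  exists ((t * (q ^ 2) ^ k.+1) %% M)%N; first by apply/mem_cyc_coset => //; exists k.+1.
  rewrite root_frob Ncq modnMml [((q ^ 2) ^ _.+1)%N]expnSr.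
  by rewrite -!mulnA [(q * (_ * _))%N]mulnC -mulnA mulnn.
move=> y; rewrite mem_cat => /orP[] /mapP[s /(mem_cyc_coset M_gt0 q2M)[k ->] ->].
  by exists (2 * k)%N; rewrite root_frob modnMml expnM cq2k.
exists (2 * k).+1; rewrite root_frob modnMml [(q ^ _.+1)%N in RHS]expnSr expnM exprM cq2k cq.
by rewrite -mulnA [(q * _)%N]mulnC.
Qed.
End IrreducibleFactors.

(** * From a factorization of [X^N - mu] over [L] to generators of codes *)

Section Generation.
Variables (F : finFieldType) (L : fieldExtType F).

Lemma irreducible_image_family (I : eqType) (r : seq I) (G : I -> {poly L}) :
  {in r, forall i, irreducible_image (G i)} ->
  exists G0 : I -> {poly F}, {in r, forall i,
    [/\ irreducible_poly (G0 i), G0 i \is monic & map_poly (in_alg L) (G0 i) = G i]}.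
Proof.
elim: r => [|i0 r IHr] G_irr; first by exists (fun=> 0).
have [|G0 G0P] := IHr; first by move=> i ir; apply: G_irr; rewrite inE ir orbT.
have [g gP] := G_irr i0 (mem_head _ _).
exists (fun i => if i == i0 then g else G0 i) => i.
by rewrite inE; case: eqP => [->|_ /G0P].
Qed.

(** The factorization is pulled back to [F] by injectivity of the coefficient map, where the monic
    generator of [C] divides it; the result is then mapped back to [L]. *)
Lemma constacyclic_generated_by N (mu : F) (C : {vspace 'rV[F]_N})
    (I : eqType) (r : seq I) (G : I -> {poly L}) k :
  (0 < N)%N -> constacyclic mu C ->
  uniq r -> {in r, forall i, irreducible_image (G i)} ->
  'X^N - (mu%:A)%:P = \prod_(i <- r) G i ^+ k ->
  exists2 eps : I -> nat, forall i, (eps i <= k)%N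
    & generated_by mu C (\prod_(i <- r) G i ^+ eps i).
Proof.
move=> N_gt0 C_cyc r_uniq /irreducible_image_family[G0 G0P] XN_eq.
have map_prod (eps : I -> nat) :
    map_poly (in_alg L) (\prod_(i <- r) G0 i ^+ eps i) = \prod_(i <- r) G i ^+ eps i.
  by rewrite rmorph_prod; apply: eq_big_seq => i /G0P[_ _ <-]; rewrite rmorphXn.
have [g [g_mon g_dvd gC]] := constacyclic_generator N_gt0 C_cyc.
have XN_eq0 : 'X^N - mu%:P = \prod_(i <- r) G0 i ^+ k.
  apply: (@map_poly_inj _ _ (in_alg L)).
  by rewrite (map_prod (fun=> k)) -XN_eq rmorphB /= map_polyXn map_polyC.
rewrite XN_eq0 in g_dvd.
have [i /G0P[] //|eps le_eps g_eq] :=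
  monic_dvdp_prod_irreducible_exp r_uniq _ g_mon g_dvd.
by exists eps => //; exists g; rewrite {1}g_eq.
Qed.

Variables (eta : L) (l m e : nat) (rho : nat -> nat).
Local Notation q := #|F|.
Local Notation M := (l ^ m)%N.
Hypotheses (eta_prim : M.-primitive_root eta) (qM : coprime q M).
Hypothesis rho_inj : forall i j, (i <= e)%N -> (j <= e)%N -> i != j ->
     ~ (cyc_coset #|F| M (rho i) =i cyc_coset #|F| M (rho j)).
Hypothesis rho_cover : forall s, (s < M)%N ->
     exists2 i, (i <= e)%N & s \in cyc_coset #|F| M (rho i).

(** As [M] is odd, [c] and [- c] contribute [X^M - c^-M] and [X^M + c^-M]. Raising to the power
    [p^n] is additive, and the resulting constant [c^-(2 M p^n)] is [mu]. *)
Lemma Xn_sub_factor p n (mu : F) (c : L) :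
  prime p -> p \in [pchar F] -> odd M -> c != 0 -> c ^+ (2 * M * p ^ n) * mu%:A = 1 ->
  'X^(2 * M * p ^ n) - (mu%:A)%:P =
  \prod_(0 <= i < e.+1)
    (hatc (cyc_poly eta q M (rho i)) c * hatc (cyc_poly eta q M (rho i)) (- c)) ^+ (p ^ n).
Proof.
move=> p_pr pF M_odd c0 c_mu.
rewrite prodrXl big_split /= !(prod_hatc_cyc_poly qM eta_prim) ?oppr_eq0 //.
have p_nat : [pchar {poly L}].-nat (p ^ n)%N.
  by rewrite pnatX pnatE // pchar_poly pchar_lalg pF.
have -> : (- c) ^- M = - c ^- M by rewrite exprNn -signr_odd M_odd mulN1r invrN.
rewrite polyCN opprK -subr_sqr exprDn_pchar // exprNn_pchar // -!polyC_exp.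
have -> : (c ^- M ^+ 2) ^+ (p ^ n) = c ^- (2 * M * p ^ n).
  by rewrite -exprVn -!exprM mulnA [(M * 2)%N]mulnC exprVn.
rewrite -!exprM mulnA [(M * 2)%N]mulnC.
by rewrite -[mu%:A](mulKf (expf_neq0 (2 * M * p ^ n)%N c0)) c_mu mulr1.
Qed.
End Generation.

(** * Roots and squares in the multiplicative group of [F] *)

Section FiniteFieldPowers.
Variable F : finFieldType.
Local Notation q := #|F|.

Lemma expf_card_pred (u : F) : u != 0 -> u ^+ q.-1 = 1.
Proof.
move=> u0; apply: (mulfI u0).
by rewrite -exprS prednK ?finField_card_gt0 // expf_card mulr1.
Qed.

(** Euler's theorem makes [d^(totient - 1)] an inverse of [d] modulo [q - 1]. *)
Lemma finField_root_coprime d (u : F) : coprime d q.-1 -> u != 0 ->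
  exists2 a : F, a != 0 & a ^+ d = u.
Proof.
move=> dq u0; exists (u ^+ (d ^ (totient q.-1).-1)); first by rewrite expf_neq0.
have q1_gt0 : (0 < q.-1)%N by rewrite -ltnS prednK ?finField_card_gt0 // finNzRing_gt1.
rewrite -exprM -expnSr prednK ?totient_gt0 //.
rewrite -(expr_mod _ (expf_card_pred u0)) cyclic.Euler_exp_totient //.
by rewrite (expr_mod _ (expf_card_pred u0)).
Qed.

Lemma odd_card_finField p : odd p -> p \in [pchar F] -> odd q.
Proof. by move=> p_odd pF; rewrite (card_pprimeChar pF) oddX p_odd orbT. Qed.

Lemma pchar_dvd_card p : p \in [pchar F] -> (p %| q)%N.
Proof.
move=> pF; have := finNzRing_gt1 F; rewrite (card_pprimeChar pF).
by case: logn => // k _; rewrite expnS dvdn_mulr.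
Qed.

(** Since [q - 1] is even, the parity of an exponent of [xi] is well defined. *)
Lemma prim_root_pow_sqr (xi : F) k : odd q -> q.-1.-primitive_root xi ->
  (exists j, xi ^+ k = (xi ^+ 2) ^+ j) -> ~~ odd k.
Proof.
move=> q_odd xi_prim [j]; rewrite -exprM => /eqP.
have d2 : (2 %| q.-1)%N by rewrite dvdn2 -subn1 oddB ?finField_card_gt0 // q_odd.
rewrite (eq_prim_root_expr xi_prim) => /eqP /(congr1 (modn^~ 2)).
by rewrite !modn_dvdm // modnMr => /eqP; rewrite -/(dvdn 2 k) dvdn2.
Qed.
End FiniteFieldPowers.

Lemma prim_root_neq0 (R : nzRingType) k (z : R) : k.-primitive_root z -> z != 0.
Proof.
move=> z_prim; apply/eqP => z0; have /eqP := prim_expr_order z_prim.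
by rewrite z0 expr0n eqn0Ngt (prim_order_gt0 z_prim) eq_sym oner_eq0.
Qed.

Lemma cyc_coset0 Q M : (0 < M)%N -> coprime Q M -> cyc_coset Q M 0 = [:: 0%N].
Proof.
move=> M_gt0 QM; apply: perm_small_eq => //; apply: uniq_perm; rewrite ?cyc_coset_uniq //.
move=> s; rewrite inE; apply/(mem_cyc_coset M_gt0 QM)/eqP => [[k ->]|->].
  by rewrite mul0n mod0n.
by exists 0%N; rewrite mul0n mod0n.
Qed.

Lemma cyc_poly0 (L : fieldType) (eta : L) Q M : (0 < M)%N -> coprime Q M ->
  cyc_poly eta Q M 0 = 'X - 1%:P.
Proof. by move=> M_gt0 QM; rewrite /cyc_poly cyc_coset0 // big_seq1. Qed.

Lemma cyc_poly_split (L : fieldType) (eta : L) q M t : (0 < M)%N -> coprime q M ->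
  (forall i j, ~~ odd i -> odd j -> t * q ^ i <> t * q ^ j %[mod M])%N ->
  cyc_poly eta q M t = cyc_poly eta (q ^ 2) M t * cyc_poly eta (q ^ 2) M (t * q).
Proof.
move=> M_gt0 qM t_sep.
by rewrite /cyc_poly -(perm_big _ (cyc_coset_split M_gt0 qM t_sep)) big_cat.
Qed.

Theorem theorem3p2
  (F : finFieldType) (p l m n : nat) (xi lam : F)
  (L : fieldExtType F) (eta alpha1 beta1 : L)
  (e : nat) (rho : nat -> nat)
  (C : {vspace 'rV[F]_(2 * l ^ m * p ^ n)%N}) :
  (* the base field F_q, q = #|F|, of odd characteristic p *)
  prime p -> odd p -> p \in [pchar F] ->
  (* xi generates F_q^* *)
  (#|F|.-1).-primitive_root xi ->
  (* l odd prime, l <> p, gcd(l, q-1) = 1; m, n positive *)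
  prime l -> odd l -> l != p -> coprime l #|F|.-1 ->
  (0 < m)%N -> (0 < n)%N ->
  (* eta a primitive l^m-th root of unity in the extension L *)
  (l ^ m)%N.-primitive_root eta ->
  (* alpha1^2 = xi, beta1 primitive 2(q-1)-th root of unity with beta1^{l^m} alpha1 = 1 *)
  alpha1 ^+ 2 = xi%:A ->
  (2 * #|F|.-1)%N.-primitive_root beta1 ->
  beta1 ^+ (l ^ m) * alpha1 = 1 ->
  (* rho_0 = 0, rho_1, ..., rho_e represent all distinct q-cyclotomic cosets mod l^m *)
  rho 0%N = 0%N ->
  (forall i j, (i <= e)%N -> (j <= e)%N -> i != j ->
     ~ (cyc_coset #|F| (l ^ m) (rho i) =i cyc_coset #|F| (l ^ m) (rho j))) ->
  (forall s, (s < l ^ m)%N ->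
     exists2 i, (i <= e)%N & s \in cyc_coset #|F| (l ^ m) (rho i)) ->
  (* C is a lam-constacyclic code of length 2 l^m p^n *)
  lam != 0 ->
  constacyclic lam C ->
  let q := #|F| in
  let N := (2 * l ^ m * p ^ n)%N in
  let M t := cyc_poly eta q (l ^ m) t in
  let Nq t := cyc_poly eta (q ^ 2) (l ^ m) t in
  let f := ord_mod l q in
  let in_sq := exists k : nat, lam = (xi ^+ 2) ^+ k in
  (in_sq /\
   exists2 a : F, a != 0 & a ^+ N * lam = 1 /\
   exists eps eps' : nat -> nat,
     (forall i, (i <= e)%N -> (eps i <= p ^ n)%N /\ (eps' i <= p ^ n)%N) /\
     generated_by lam C
       (\prod_(0 <= i < e.+1)
          (hatc (M (rho i)) a%:A ^+ eps i * hatc (M (rho i)) (- a%:A) ^+ eps' i)))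
  \/
  (~ in_sq /\
   exists2 b : F, b != 0 & b ^+ N * lam = xi ^+ (p ^ n) /\
   (odd f ->
     let S i := hatc (M (rho i)) beta1 * hatc (M (rho i)) (- beta1) in
     exists eps : nat -> nat,
       (forall i, (i <= e)%N -> (eps i <= p ^ n)%N) /\
       generated_by lam C
         (\prod_(0 <= i < e.+1) hatc (S i) b%:A ^+ eps i)) /\
   (~~ odd f ->
     let P := ('X - (beta1^-1)%:P) * ('X + (beta1^-1)%:P) in
     let Q i := hatc (Nq (rho i)) beta1 * hatc (Nq (rho i * q)%N) (- beta1) in
     let R i := hatc (Nq (rho i * q)%N) beta1 * hatc (Nq (rho i)) (- beta1) in
     exists (eps0 : nat) (eps eps' : nat -> nat),
       (eps0 <= p ^ n)%N /\
       (forall i, (1 <= i <= e)%N -> (eps i <= p ^ n)%N /\ (eps' i <= p ^ n)%N) /\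
       generated_by lam C
         (hatc P b%:A ^+ eps0 *
          \prod_(1 <= i < e.+1) (hatc (Q i) b%:A ^+ eps i * hatc (R i) b%:A ^+ eps' i)))).
Proof.
move=> p_pr p_odd pF xi_prim l_pr l_odd l_neq_p lq m_gt0 n_gt0 eta_prim alpha_sqr.
move=> beta_prim beta_alpha rho0 rho_inj rho_cover lam0 C_cyc q N M Nq f in_sq.
have q_odd : odd q := odd_card_finField p_odd pF.
have q_gt0 : (0 < q)%N := finField_card_gt0 F.
have Lm_gt0 : (0 < l ^ m)%N := prim_order_gt0 eta_prim.
have Lm_odd : odd (l ^ m)%N by rewrite oddX l_odd orbT.
have ql : coprime q l.
  rewrite /q (card_pprimeChar pF) coprimeXl // prime_coprime // dvdn_prime2 //.
  by rewrite eq_sym.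
have qM : coprime q (l ^ m) by rewrite coprimeXr.
have N_gt0 : (0 < N)%N by rewrite !muln_gt0 Lm_gt0 expn_gt0 (prime_gt0 p_pr).
have dq : coprime (l ^ m * p ^ n) q.-1.
  rewrite coprimeMl !coprimeXl // (coprime_dvdl (pchar_dvd_card pF)) //.
  by rewrite coprimenP.
have N1 : -1 != 1 :> L.
  apply/eqP => /esym/eqP; rewrite -subr_eq0 opprK -mulr2n.
  rewrite -(dvdn_pcharf (p := p)) ?pchar_lalg // dvdn_prime2 // => /eqP p2.
  by move: p_odd; rewrite p2.
have xi0 : xi != 0 := prim_root_neq0 xi_prim.
have [k lam_k] : exists k, lam = xi ^+ k.
  by have [k ->] := prim_rootP xi_prim (expf_card_pred lam0); exists k.
have NE : N = (l ^ m * p ^ n * 2)%N by rewrite /N -mulnA mulnC.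
(* The parity of the discrete logarithm [k] of [lam] separates (A) from (B). *)
have [k_odd|k_even] := boolP (odd k); [right|left]; last first.
  split; first by exists k./2; rewrite -exprM mul2n even_halfK.
  have [a a0 a_root] : exists2 a : F, a != 0 & a ^+ (l ^ m * p ^ n) = xi ^- k./2.
    by apply: finField_root_coprime; rewrite ?invr_eq0 ?expf_neq0.
  have a_lam : a ^+ N * lam = 1.
    rewrite NE exprM a_root exprVn -exprM muln2 even_halfK // lam_k mulVf //.
    by rewrite expf_neq0.
  exists a => //; split=> //.
  have aA0 : (a%:A : L) != 0 by rewrite -[a%:A]/(in_alg L a) fmorph_eq0.
  (* A factor is indexed by its coset and the sign of [a]. *)
  pose G (ib : nat * bool) := hatc (M (rho ib.1)) (if ib.2 then a%:A else - a%:A).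
  pose r := [seq (i, b) | i <- index_iota 0 e.+1, b <- [:: true; false]].
  have G_prod (u : nat * bool -> nat) : \prod_(ib <- r) G ib ^+ u ib =
    \prod_(0 <= i < e.+1) (hatc (M (rho i)) a%:A ^+ u (i, true) *
                            hatc (M (rho i)) (- a%:A) ^+ u (i, false)).
    by rewrite big_allpairs; apply: eq_bigr => i _; rewrite !big_cons big_nil /= mulr1.
  have [|||eps le_eps C_gen] := @constacyclic_generated_by F L N lam C _ r G (p ^ n) N_gt0 C_cyc.
  - by apply: allpairs_uniq; rewrite ?iota_uniq // => -[? ?] [? ?].
  - move=> [i b] _; rewrite /G /=; apply: irreducible_cyc_poly => //.
      by case: b; rewrite ?oppr_eq0.
    have := expf_card_in_alg L a; case: b => // aq.
    by rewrite -[LHS]/(frob_card (- a%:A)) rmorphN /= /frob_card aq.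
  - rewrite (G_prod (fun=> (p ^ n)%N)).
    rewrite (Xn_sub_factor eta_prim qM rho_inj rho_cover p_pr pF Lm_odd aA0).
      by apply: eq_bigr => i _; rewrite exprMn.
    by rewrite -[a%:A]/(in_alg L a) -rmorphXn -rmorphM /= a_lam scale1r.
  exists (fun i => eps (i, true)), (fun i => eps (i, false)); split=> //.
  by rewrite -G_prod.
split.
  case=> j lam_j; move: k_odd; apply/negP; apply: (prim_root_pow_sqr q_odd xi_prim).
  by exists j; rewrite -lam_k.
have pn_odd : odd (p ^ n) by rewrite oddX p_odd orbT.
(* Both [p^n] and [k] are odd, so [xi^(p^n) / lam] is the square of this quotient with rounded-down
   halves. *)
have [b b0 b_root] : exists2 b : F, b != 0 & b ^+ (l ^ m * p ^ n) = xi ^+ (p ^ n)./2 / xi ^+ k./2.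
  by apply: finField_root_coprime; rewrite ?mulf_neq0 ?invr_eq0 ?expf_neq0.
have b_lam : b ^+ N * lam = xi ^+ (p ^ n).
  have xi_odd j : odd j -> xi ^+ j = xi * xi ^+ j./2.*2.
    by move=> j_odd; rewrite -exprS -[in LHS](odd_double_half j) j_odd.
  rewrite NE exprM b_root expr_div_n -!exprM !muln2 lam_k (xi_odd k) // (xi_odd (p ^ n)%N) //.
  by rewrite mulrCA divfK // expf_neq0.
exists b => //; split=> //.
have bA0 : (b%:A : L) != 0 by rewrite -[b%:A]/(in_alg L b) fmorph_eq0.
have beta0 : beta1 != 0 := prim_root_neq0 beta_prim.
have Nbeta0 : - beta1 != 0 by rewrite oppr_eq0.
(* The nested substitutions by [beta1] and [b] amount to the single scale [c]. *)
pose c : L := beta1 * b%:A.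
have c0 : c != 0 by rewrite mulf_neq0.
have Nc0 : - c != 0 by rewrite oppr_eq0.
(* [beta1^(q-1)] squares to [1] but is not [1], because [beta1] has order [2(q-1)]; so it is
   [-1]. *)
have beta_q : beta1 ^+ q = - beta1.
  have : (beta1 ^+ q.-1) ^+ 2 == 1 by rewrite -exprM mulnC prim_expr_order.
  rewrite sqrf_eq1 -(prim_order_dvd beta_prim) => /orP[/dvdn_leq|/eqP bq].
    move=> /(_ (prim_order_gt0 xi_prim)).
    by rewrite leqNgt mul2n -addnn -[ltnLHS]addn0 ltn_add2l (prim_order_gt0 xi_prim).
  by rewrite -(prednK q_gt0) exprS bq mulrN1.
have cq : c ^+ q = - c by rewrite exprMn beta_q expf_card_in_alg mulNr.
have Ncq : (- c) ^+ q = - - c by rewrite -[LHS]/(frob_card (- c)) rmorphN /= /frob_card cq.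
have c_lam : c ^+ N * lam%:A = 1.
  rewrite exprMn -mulrA.
  have -> : (b%:A : L) ^+ N * lam%:A = (xi%:A) ^+ (p ^ n).
    rewrite -[b%:A]/(in_alg L b) -[lam%:A]/(in_alg L lam) -rmorphXn -rmorphM /= b_lam.
    by rewrite -[xi%:A]/(in_alg L xi) -rmorphXn.
  rewrite /N -alpha_sqr exprM -exprMn [(2 * _)%N]mulnC exprM -exprMn.
  by rewrite beta_alpha !expr1n.
have XN := Xn_sub_factor eta_prim qM rho_inj rho_cover p_pr pF Lm_odd c0 c_lam.
have hat2 Q' t : hatc (hatc (cyc_poly eta Q' (l ^ m) t) beta1) b%:A =
    hatc (cyc_poly eta Q' (l ^ m) t) c.
  exact: hatc_hatc_cyc_poly.
have hatN2 Q' t : hatc (hatc (cyc_poly eta Q' (l ^ m) t) (- beta1)) b%:A =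
    hatc (cyc_poly eta Q' (l ^ m) t) (- c).
  by rewrite hatc_hatc_cyc_poly // mulNr.
split.
  move=> f_odd S.
  have S_eq i : hatc (S i) b%:A = hatc (M (rho i)) c * hatc (M (rho i)) (- c).
    by rewrite hatcM hat2 hatN2.
  have [|||eps le_eps C_gen] := @constacyclic_generated_by F L N lam C _ (index_iota 0 e.+1)
    (fun i => hatc (S i) b%:A) (p ^ n) N_gt0 C_cyc.
  - exact: iota_uniq.
  - move=> i _; rewrite S_eq.
    have [_ qf _] := ord_modP l_pr ql.
    (* [l ^ m.-1] is odd, so the odd order modulo [l] yields an odd period modulo [l^m], and both
       [q^2]-cosets equal the [q]-coset. *)
    have qfM := expn_prime_power_mod l_pr ql m_gt0 qf.
    have d_odd : odd (ord_mod l q * l ^ m.-1) by rewrite oddM f_odd oddX l_odd orbT.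
    have := irreducible_twisted_cyc_poly eta_prim qM (rho i) Lm_odd N1 c0 cq.
    rewrite (perm_cyc_poly eta (cyc_coset_odd_period Lm_gt0 qM (rho i) d_odd qfM)).
    by rewrite (perm_cyc_poly eta (cyc_coset_odd_period_mul Lm_gt0 qM (rho i) d_odd qfM)).
  - by rewrite XN; apply: eq_bigr => i _; rewrite S_eq.
  by exists eps.
move=> f_even P Q R.
have q2M : coprime (q ^ 2) (l ^ m) by apply: coprime_sqr.
have Q_eq i : hatc (Q i) b%:A = hatc (Nq (rho i)) c * hatc (Nq (rho i * q)%N) (- c).
  by rewrite hatcM hat2 hatN2.
have R_eq i : hatc (R i) b%:A = hatc (Nq (rho i * q)%N) c * hatc (Nq (rho i)) (- c).
  by rewrite hatcM hat2 hatN2.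
have N0 : Nq 0%N = 'X - 1%:P by apply: cyc_poly0.
have M0 : M 0%N = 'X - 1%:P by apply: cyc_poly0.
(* Since [D_0 = {0}], [P] is the twisted factor at [t = 0]. *)
have P_eq : hatc P b%:A = hatc (Nq 0%N) c * hatc (Nq 0%N) (- c).
  rewrite -hat2 -hatN2 -hatcM -/(Nq 0%N) N0 !hatc_XsubC // !mulr1 invrN.
  by rewrite polyCN opprK.
pose G (ib : nat * bool) := if ib.1 == 0%N then hatc P b%:A else
  if ib.2 then hatc (Q ib.1) b%:A else hatc (R ib.1) b%:A.
pose r := (0%N, true) :: [seq (i, b) | i <- index_iota 1 e.+1, b <- [:: true; false]].
have G_prod (u : nat * bool -> nat) : \prod_(ib <- r) G ib ^+ u ib =
    hatc P b%:A ^+ u (0%N, true) * \prod_(1 <= i < e.+1)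
      (hatc (Q i) b%:A ^+ u (i, true) * hatc (R i) b%:A ^+ u (i, false)).
  rewrite big_cons big_allpairs; congr (_ * _); apply: eq_big_nat => i /andP[i_gt0 _].
  by rewrite !big_cons big_nil /= mulr1 /G /= (gtn_eqF i_gt0).
have [|||eps le_eps C_gen] := @constacyclic_generated_by F L N lam C _ r G (p ^ n) N_gt0 C_cyc.
- rewrite /r cons_uniq allpairs_uniq ?iota_uniq ?andbT // => [|[? ?] [? ?]] //.
  by apply/allpairsP => -[[i b'] /= [+ _ [i0 _]]]; rewrite -i0 mem_index_iota.
- move=> [i b'] _; rewrite /G /=; case: eqP => _.
    by rewrite P_eq -{2}(mul0n q); apply: irreducible_twisted_cyc_poly.
  case: b'; rewrite ?Q_eq ?R_eq; first exact: irreducible_twisted_cyc_poly.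
  (* [R i] is [Q i] with [c] replaced by [- c], which Frobenius also negates. *)
  rewrite -[X in hatc (Nq _) X]opprK mulrC.
  exact: irreducible_twisted_cyc_poly.
- rewrite (G_prod (fun=> (p ^ n)%N)) XN big_ltn // rho0 -/(M 0%N) M0 P_eq N0.
  congr (_ * _); apply: eq_big_nat => i /andP[i_gt0 le_ie].
  (* Otherwise the coset of [rho i] would contain [0] and coincide with that of [rho 0]. *)
  have rho_ndvd : ~~ (l ^ m %| rho i)%N.
    apply/negP => rho_dvd; have := rho_inj i 0%N le_ie (leq0n _) (lt0n_neq0 i_gt0).
    apply; apply: (@cyc_coset_eq _ _ Lm_gt0 qM _ _ 0%N).
      by rewrite -(eqP rho_dvd) mem_cyc_coset_id.
    by rewrite rho0 cyc_coset0 // mem_seq1.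
  have t_sep := even_ord_mod_sep l_pr ql m_gt0 f_even rho_ndvd.
  (* Each of the two signs yields factors for [D_t] and [D_(tq)]; pairing opposite signs across
     these cosets gives [Q i] and [R i]. *)
  rewrite -exprMn Q_eq R_eq (cyc_poly_split eta Lm_gt0 qM) ?hatcM; last by move=> *; apply: t_sep.
  by congr (_ ^+ _); rewrite [X in _ * X = _]mulrC mulrACA.
exists (eps (0%N, true)), (fun i => eps (i, true)), (fun i => eps (i, false)).
by do 2!split=> //; rewrite -G_prod.
Qed.
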